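(* Consider the homogeneous i.i.d. product case: $(E_n)_{n\in\mathbb{N}}$ is i.i.d. under $\mathbb{P}_1$ with common law that of a single e-variable $E$, $c:=\mathbb{E}_{P_1}[\log E]$, and $\psi$ is a majorant for one step, so that $C_t=tc$, $\Psi^{(t)}=t\psi$ are an aggregate. Let $s^{\ast}(c)$ be any maximiser in $\psi^{\star}(c)=\sup_s\{sc-\psi(s)\}$, assumed to exist; equivalently, any element of the superdifferential of $\psi^{\star}$ at $c$. When $\psi$ is finite, differentiable and strictly convex on $(0,s_{\max})$ this is the unique solution of $\psi'(s^{\ast})=c$, and when $\psi$ is the chord $\psi(s)=\frac{s}{s_0}\kappa$ for $0\le s\le s_0$, $\psi(s)=+\infty$ for $s>s_0$, it is $s_0$. Then for every $t$ with $tc\ge\ell$, $$\gamma_t(\alpha)\le\alpha^{-s^{\ast}(c)}e^{-t\,\psi^{\star}(c)}=\exp\big(-t\,\psi^{\star}(c)+s^{\ast}(c)\,\ell\big).$$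
   Context: I.i.d. setting: $(\mathcal{X},\mathcal{B})$ is a measurable space, $P_0,P_1$ probability measures on it with $P_1\ll P_0$; $\Omega=\mathcal{X}^{\mathbb{N}}$ with coordinate process $(X_n)_{n\in\mathbb{N}}$, $\mathcal{F}_t=\sigma(X_1,\dots,X_t)$, $\mathbb{P}_i=P_i^{\otimes\mathbb{N}}$. The sequence $(E_n)$ is a betting sequence: $E_n:\Omega\to[0,\infty]$ is $\mathcal{F}_n$-measurable with $\mathbb{E}_{\mathbb{P}_0}[E_n\mid\mathcal{F}_{n-1}]\le1$ $\mathbb{P}_0$-a.s.; an e-variable $E\ge0$ satisfies $\mathbb{E}_{P_0}[E]\le1$. Wealth $W_t=\prod_{n\le t}E_n$; for $\alpha\in(0,1)$ and $t\in\mathbb{N}$, $\ell:=\log\frac1\alpha$ and $\gamma_t(\alpha):=\mathbb{P}_1(W_t\le\frac1\alpha)$; $\log$ is natural. A majorant for one step, with $s_{\max}\in(0,\infty]$, is a function $\psi:[0,s_{\max})\to[0,\infty]$ with $\psi(0)=0$ and $\log\mathbb{E}_{P_1}[e^{-s(\log E-c)}]\le\psi(s)$ for all $s\in[0,s_{\max})$. That $(C_t,\Psi^{(t)})=(tc,t\psi)$ is an aggregate means that $c$ and $\psi$ serve at every step $n$: $\mathbb{E}_{\mathbb{P}_1}[\log E_n\mid\mathcal{F}_{n-1}]\ge c$ and $\log\mathbb{E}_{\mathbb{P}_1}[e^{-s(\log E_n-c)}\mid\mathcal{F}_{n-1}]\le\psi(s)$ $\mathbb{P}_1$-a.s., so that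 their sums over $n\le t$ are bounded by $tc$ (below) and $t\psi$ (above). Rate function: $\psi^{\star}(x):=\sup_{s\in[0,s_{\max})}\{sx-\psi(s)\}$ for $x\ge0$. ''Superdifferential of $\psi^{\star}$ at $c$'' refers to the slopes $\sigma$ with $\psi^{\star}(x)\ge\psi^{\star}(c)+\sigma(x-c)$ for all $x\ge0$. The chord arises when one assumes $\mathbb{E}_{P_1}[E^{-s_0}]\le\rho$ for one fixed $s_0>0$, with $\kappa=\log\rho+s_0c\ge0$ (and $s_{\max}=\infty$).
   Formalization: Side claims corrected: slope⇒maximiser for ψ convex, lsc, slope in [0,s_max); ψ'(s* )=c for s*>0, a solution is the maximiser if ψ(0+)=0; chord: s_0 maximises if ρ≤1, uniquely if ρ<1; aggregate if E_n is independent of F_{n-1}. The bound is unrestricted. *)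

(* Defs.v *)
From HB Require Import structures.
From mathcomp Require Import all_boot all_order all_algebra.
From mathcomp Require Import all_classical all_reals all_analysis.
From mathcomp Require Import measurable_realfun.

Set Implicit Arguments.
Unset Strict Implicit.
Unset Printing Implicit Defensive.

Import Order.TTheory GRing.Theory Num.Theory.
Import numFieldNormedType.Exports.

Local Open Scope classical_set_scope.
Local Open Scope ring_scope.
Local Open Scope ereal_scope.

(* Time is 0-based: the coordinate w k is the observation X_(k+1) of the
   mathematical text, and Es k is the factor E_(k+1). *)

Definition coord_events d (X : measurableType d) (K : set nat) :
    set (set (nat -> X)) :=
  [set C | exists k (B : set X),
    [/\ K k, measurable B & C = [set w | B (w k)]]].
Arguments coord_events {d} X K.

(* X^N with the sigma-algebra generated by all the coordinates *)
Notation seqspace X := (g_sigma_algebraType (coord_events X setT)).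

(* sigma(X_1, .., X_n); the trivial sigma-algebra when n = 0 *)
Definition past d (X : measurableType d) (n : nat) : set (set (seqspace X)) :=
  <<s coord_events X `I_n >>.
Arguments past {d} X n.

(* PP is the infinite product of P; the library does not construct this
   measure, but its values on cylinders determine it. *)
Definition is_iid_law d (X : measurableType d) (R : realType)
    (P : probability X R) (PP : probability (seqspace X) R) : Prop :=
  forall (n : nat) (B : nat -> set X), (forall k, measurable (B k)) ->
    PP [set w | forall k, (k < n)%N -> B k (w k)] =
    \big[*%E/1]_(k < n) P (B k).

Definition measurable_wrt T (R : realType) (G : set (set T))
    (f : T -> \bar R) : Prop :=
  forall B : set (\bar R), measurable B -> G (f @^-1` B).

(* Z is a version of the conditional expectation of Y given G. It is used only
   for Y nonnegative or integrable: for an integrable Y, all the integrals of Z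
   over G are finite, hence Z is integrable too. *)
Definition is_cond_exp d (T : measurableType d) (R : realType)
    (PP : probability T R) (G : set (set T)) (Y Z : T -> \bar R) : Prop :=
  measurable_wrt G Z /\
  forall A, G A -> \int[PP]_(w in A) Z w = \int[PP]_(w in A) Y w.

Definition e_variable d (X : measurableType d) (R : realType)
    (P0 : probability X R) (E : X -> \bar R) : Prop :=
  [/\ measurable_fun setT E, forall x, 0 <= E x & \int[P0]_x E x <= 1].

Definition betting_sequence d (X : measurableType d) (R : realType)
    (PP0 : probability (seqspace X) R) (Es : nat -> seqspace X -> \bar R) :
    Prop :=
  forall n,
    [/\ forall w, 0 <= Es n w,
        measurable_wrt (past X n.+1) (Es n) &
        exists2 Z, is_cond_exp PP0 (past X n) (Es n) Z &
          {ae PP0, forall w, Z w <= 1}].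

(* Independence of a sequence; taking B k = setT for some of the k gives the
   product rule for arbitrary finite subfamilies. *)
Definition independent_seq d (T : measurableType d) (R : realType)
    (PP : probability T R) (Es : nat -> T -> \bar R) : Prop :=
  forall (n : nat) (B : nat -> set (\bar R)), (forall k, measurable (B k)) ->
    PP [set w | forall k, (k < n)%N -> B k (Es k w)] =
    \big[*%E/1]_(k < n) PP (Es k @^-1` B k).

Definition iid_as d (X : measurableType d) (R : realType)
    (P1 : probability X R) (E : X -> \bar R)
    (PP1 : probability (seqspace X) R) (Es : nat -> seqspace X -> \bar R) :
    Prop :=
  independent_seq PP1 Es /\
  forall n (B : set (\bar R)), measurable B ->
    PP1 (Es n @^-1` B) = P1 (E @^-1` B).

Definition independent_of_past d (X : measurableType d) (R : realType)
    (PP1 : probability (seqspace X) R) (Es : nat -> seqspace X -> \bar R) :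
    Prop :=
  forall n (A : set (seqspace X)) (B : set (\bar R)),
    past X n A -> measurable B ->
    PP1 (A `&` Es n @^-1` B) = PP1 A * PP1 (Es n @^-1` B).

Definition wealth T (R : realType) (Es : nat -> T -> \bar R) (t : nat)
    (w : T) : \bar R :=
  \big[*%E/1]_(k < t) Es k w.

Definition gamma d (T : measurableType d) (R : realType)
    (PP1 : probability T R) (Es : nat -> T -> \bar R) (t : nat) (alpha : R) :
    \bar R :=
  PP1 [set w | wealth Es t w <= (alpha^-1)%:E].

(* [0, smax); functions on it are represented by total functions on R, whose
   values outside are irrelevant. *)
Definition sdom (R : realType) (smax : \bar R) : set R :=
  [set s | (0 <= s)%R /\ s%:E < smax].

(* exp (- s (log e - c)). The power function poweR is not used because it
   maps 0 to 0 for negative exponents, instead of +oo. *)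
Definition tilt (R : realType) (c s : R) (e : \bar R) : \bar R :=
  expeR (- (s%:E * (lne e - c%:E))).

Definition majorant d (X : measurableType d) (R : realType)
    (P1 : probability X R) (E : X -> \bar R) (c : R) (smax : \bar R)
    (psi : R -> \bar R) : Prop :=
  [/\ psi 0%R = 0,
      forall s, sdom smax s -> 0 <= psi s &
      forall s, sdom smax s -> lne (\int[P1]_x tilt c s (E x)) <= psi s].

(* (t c, t psi) is an aggregate *)
Definition homogeneous_aggregate d (X : measurableType d) (R : realType)
    (PP1 : probability (seqspace X) R) (Es : nat -> seqspace X -> \bar R)
    (c : R) (smax : \bar R) (psi : R -> \bar R) : Prop :=
  forall n,
    (exists2 Z, is_cond_exp PP1 (past X n) (fun w => lne (Es n w)) Z &
       {ae PP1, forall w, c%:E <= Z w}) /\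
    (forall s, sdom smax s ->
       exists2 Z, is_cond_exp PP1 (past X n) (fun w => tilt c s (Es n w)) Z &
         {ae PP1, forall w, lne (Z w) <= psi s}).

Definition rate (R : realType) (smax : \bar R) (psi : R -> \bar R) (x : R) :
    \bar R :=
  ereal_sup [set (s * x)%:E - psi s | s in sdom smax].

Definition maximiser (R : realType) (smax : \bar R) (psi : R -> \bar R)
    (c s : R) : Prop :=
  sdom smax s /\ (s * c)%:E - psi s = rate smax psi c.

Definition superdifferential (R : realType) (smax : \bar R)
    (psi : R -> \bar R) (c : R) : set R :=
  [set sigma | forall x : R, (0 <= x)%R ->
    rate smax psi c + (sigma * (x - c))%:E <= rate smax psi x].

Definition convex_on_sdom (R : realType) (smax : \bar R) (psi : R -> \bar R) :
    Prop :=
  forall (s u l : R), sdom smax s -> sdom smax u -> (0 <= l <= 1)%R ->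
    psi ((1 - l) * s + l * u)%R <= (1 - l)%:E * psi s + l%:E * psi u.

Definition lsc_on_sdom (R : realType) (smax : \bar R) (psi : R -> \bar R) :
    Prop :=
  forall (s a : R), sdom smax s -> a%:E < psi s ->
    \forall u \near nbhs s, sdom smax u -> a%:E < psi u.

Definition strictly_convex_on (R : realType) (D : set R) (f : R -> R) : Prop :=
  forall (s u l : R), D s -> D u -> s <> u -> (0 < l < 1)%R ->
    (f ((1 - l) * s + l * u) < (1 - l) * f s + l * f u)%R.

Definition sdom_int (R : realType) (smax : \bar R) : set R :=
  [set s | (0 < s)%R /\ s%:E < smax].

(* Main.v *)
Require Import Defs.
From HB Require Import structures.
From mathcomp Require Import all_boot all_order all_algebra.
From mathcomp Require Import all_classical all_reals all_analysis.
From mathcomp Require Import measurable_realfun ring lra.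

(** With [l = log (1/alpha)], Markov's inequality for [W_t ^ (- s)] and
    independence give [gamma_t <= exp (- t (s x - psi s))], where
    [x = c - l / t >= 0], for every [s] in the domain; optimising over [s],
    [gamma_t <= exp (- t psi* x)]. A slope [sigma] of the superdifferential at
    [c] satisfies [psi* x >= psi* c - sigma l / t], which is the bound; a
    maximiser is such a slope because [psi*] is a supremum of affine functions.
    Conversely, convexity and lower semicontinuity provide, for every
    [a < psi s], a line of nonnegative slope through [(s, a)] below [psi]. For
    the chord with [rho > 1] the rate at [c] vanishes and the bound is at
    least 1. *)

Import Order.TTheory GRing.Theory Num.Theory.
Import numFieldNormedType.Exports.

Set Implicit Arguments.
Unset Strict Implicit.
Unset Printing Implicit Defensive.

Local Open Scope classical_set_scope.
Local Open Scope ring_scope.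
Local Open Scope ereal_scope.

(** * Measurability *)

(** An up-closed set is a ray starting at its infimum, closed or open according to whether it
    contains it. *)
Lemma measurable_up_closed (R : realType) (A : set (\bar R)) :
  (forall x y, A x -> x <= y -> A y) -> measurable A.
Proof.
move=> upA; have [Ai|Ai] := pselect (A (ereal_inf A)).
  suff -> : A = [set` `[ereal_inf A, +oo[] by exact: emeasurable_itv.
  apply/seteqP; split=> [x Ax|x] /=; rewrite in_itv/= andbT.
    exact: ereal_inf_lbound.
  exact: upA.
suff -> : A = [set` `]ereal_inf A, +oo[] by exact: emeasurable_itv.
apply/seteqP; split=> [x Ax|x] /=; rewrite in_itv/= andbT.
  rewrite lt_neqAle ereal_inf_lbound// andbT.
  by apply: contra_notN Ai => /eqP ->.
by move=> /ereal_inf_lt [y Ay /ltW]; exact: upA.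
Qed.

(** Preimages of rays are up-closed. This covers [lne] and [expeR] with their values at infinity. *)
Lemma nondecreasing_emeasurable (R : realType) (f : \bar R -> \bar R) :
  {homo f : x y / x <= y} -> measurable_fun setT f.
Proof.
move=> ndf; apply: (measurability _ (ErealGenOInfty.measurableE R)).
move=> _ [_ [r ->] <-]; rewrite setTI; apply: measurable_up_closed => x y /=.
by rewrite !in_itv/= !andbT => rx /ndf; exact: lt_le_trans.
Qed.

Lemma le_lne (R : realType) : {homo (@lne R) : x y / x <= y}.
Proof.
move=> x y xy; have [x0|x0] := leP x 0; first by rewrite le0_lneNy ?leNye.
by rewrite -lee_expeR !lneK ?in_itv/= ?leey ?andbT ?(ltW x0)// (le_trans (ltW x0)).
Qed.

Lemma measurable_tilt (R : realType) (c s : R) :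
  measurable_fun setT (@tilt R c s).
Proof.
apply: (measurableT_comp (f := @expeR R)).
  by apply: nondecreasing_emeasurable => x y; rewrite lee_expeR.
apply: measurableT_comp => //.
apply: measurable_funeM; apply: emeasurable_funB => //.
by apply: nondecreasing_emeasurable; exact: le_lne.
Qed.

Lemma tilt_ge0 (R : realType) (c s : R) e : 0 <= tilt c s e.
Proof. exact: expeR_ge0. Qed.

(** * Independence and integrals *)

(** Restricted to [A], the law of [V] is [mu A] times the law of [E]. Taking [A = setT] transfers
    integrals between equal laws; taking [A] in the past computes conditional expectations. *)
Lemma ge0_integral_indep d d' (T : measurableType d) (X : measurableType d')
    (R : realType) (mu : probability T R) (P : probability X R) (A : set T)
    (V : T -> \bar R) (E : X -> \bar R) (g : \bar R -> \bar R) :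
  measurable A -> measurable_fun setT V -> measurable_fun setT E ->
  (forall B, measurable B ->
     mu (A `&` V @^-1` B) = mu A * P (E @^-1` B)) ->
  measurable_fun setT g -> (forall y, 0 <= g y) ->
  \int[mu]_(w in A) g (V w) = mu A * \int[P]_x g (E x).
Proof.
move=> mA mV mE ind mg g0.
have mgV : measurable_fun setT (g \o V) by exact: measurableT_comp.
transitivity (\int[mrestr mu mA]_w (g \o V) w).
  rewrite [RHS](ge0_negligible_integral (measurableC mA))//; last 2 first.
  - by move=> w _; exact: g0.
  - by rewrite /= /mrestr setICl measure0.
  rewrite setTD setCK; apply: eq_measure_integral => B mB BA.
  by rewrite /= /mrestr setIidl.
have := @ge0_integral_pushforward _ _ _ _ R V mV (mrestr mu mA) setT g.
rewrite preimage_setT => <-//.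
have muA : (0 <= fine (mu A))%R by exact: fine_ge0.
rewrite (eq_measure_integral (mscale (NngNum muA) (pushforward P E))); last first.
  move=> B mB _; rewrite /= /mscale /= /pushforward /mrestr fineK ?fin_num_measure//.
  by rewrite setIC ind.
rewrite ge0_integral_mscale//= fineK ?fin_num_measure//.
by rewrite (ge0_integral_pushforward mE)// preimage_setT.
Qed.

(** A finite integral makes the integrals of both parts of [g] finite, so the nonnegative case
    applies to each and [mu A] factors out of the difference. *)
Lemma integral_indep d d' (T : measurableType d) (X : measurableType d')
    (R : realType) (mu : probability T R) (P : probability X R) (A : set T)
    (V : T -> \bar R) (E : X -> \bar R) (g : \bar R -> \bar R) (c : R) :
  measurable A -> measurable_fun setT V -> measurable_fun setT E ->
  (forall B, measurable B ->
     mu (A `&` V @^-1` B) = mu A * P (E @^-1` B)) ->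
  measurable_fun setT g -> \int[P]_x (g \o E) x = c%:E ->
  \int[mu]_(w in A) (g \o V) w = mu A * c%:E.
Proof.
move=> mA mV mE ind mg; rewrite integralE => abc; rewrite integralE.
move: abc; rewrite !(funepos_comp g V, funepos_comp g E, funeneg_comp g V, funeneg_comp g E).
rewrite (ge0_integral_indep mA mV mE ind (measurable_funepos mg))//.
rewrite (ge0_integral_indep mA mV mE ind (measurable_funeneg mg))//=.
set a := \int[P]_x g^\+ _; set b := \int[P]_x g^\- _ => abc.
have : a - b \is a fin_num by rewrite abc.
rewrite fin_numB => /andP[fa fb].
by rewrite -muleBr ?abc// ?fin_num_measure// fin_num_adde_defr.
Qed.

(** Both sides, as functions of [D], are finite measures that agree on rectangles with the product
    of the laws of [U] and [V] scaled by [mu C]; uniqueness of the product measure concludes. *)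
Lemma indep_pair_event d d1 d2 (T : measurableType d) (T1 : measurableType d1)
    (T2 : measurableType d2) (R : realType) (mu : probability T R)
    (U : T -> T1) (V : T -> T2) (C : set T) :
  measurable_fun setT U -> measurable_fun setT V -> measurable C ->
  (forall A B, measurable A -> measurable B ->
     mu (U @^-1` A `&` V @^-1` B) = mu (U @^-1` A) * mu (V @^-1` B)) ->
  (forall A B, measurable A -> measurable B ->
     mu (U @^-1` A `&` V @^-1` B `&` C) =
     mu (U @^-1` A) * mu (V @^-1` B) * mu C) ->
  forall D, measurable D ->
    mu ((fun w => (U w, V w)) @^-1` D `&` C) =
    mu ((fun w => (U w, V w)) @^-1` D) * mu C.
Proof.
move=> mU mV mC ind indC D mD.
pose U' : {mfun _ >-> _} := HB.pack U (isMeasurableFun.Build _ _ _ _ _ mU).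
pose V' : {mfun _ >-> _} := HB.pack V (isMeasurableFun.Build _ _ _ _ _ mV).
have mUV : measurable_fun setT (fun w => (U w, V w)).
  by apply: measurable_fun_pair.
have muC : (0 <= fine (mu C))%R by exact: fine_ge0.
have muCE : (fine (mu C))%:E = mu C by rewrite fineK ?fin_num_measure.
pose m1 := mscale (NngNum muC) (distribution mu U').
pose m2 := distribution mu V'.
have e1 : (m1 \x m2) D = mu ((fun w => (U w, V w)) @^-1` D `&` C).
  apply: (product_measure_unique
    (m' := pushforward (mrestr mu mC) (fun w => (U w, V w)))) => // A B mA mB.
  rewrite /= /pushforward /mrestr /m1 /m2 /= /mscale /= muCE.
  by rewrite -[RHS]muleA [RHS]muleC -indC.
have e2 : (m1 \x m2) D = mu C * mu ((fun w => (U w, V w)) @^-1` D).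
  rewrite -muCE; apply: (product_measure_unique
    (m' := mscale (NngNum muC) (pushforward mu (fun w => (U w, V w))))) => //.
  move=> A B mA mB.
  rewrite /pushforward /m1 /m2 /= /mscale /= -muleA; congr (_ * _).
  by rewrite -ind.
by rewrite -e1 e2 muleC.
Qed.

(** The joint law is the product of the two laws, and Tonelli splits the integral. *)
Lemma ge0_integral_indepM d (T : measurableType d) (R : realType)
    (mu : probability T R) (U V : T -> \bar R) :
  measurable_fun setT U -> measurable_fun setT V ->
  (forall A B, measurable A -> measurable B ->
     mu (U @^-1` A `&` V @^-1` B) = mu (U @^-1` A) * mu (V @^-1` B)) ->
  (forall w, 0 <= U w) -> (forall w, 0 <= V w) ->
  \int[mu]_w (U w * V w) = \int[mu]_w U w * \int[mu]_w V w.
Proof.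
move=> mU mV ind U0 V0.
pose U' : {mfun _ >-> _} := HB.pack U (isMeasurableFun.Build _ _ _ _ _ mU).
pose V' : {mfun _ >-> _} := HB.pack V (isMeasurableFun.Build _ _ _ _ _ mV).
have mUV : measurable_fun setT (fun w => (U w, V w)).
  by apply: measurable_fun_pair.
pose m1 := distribution mu U'; pose m2 := distribution mu V'.
(* The absolute values make the integrand nonnegative on the whole plane, as Tonelli requires,
   without changing it on the range of [(U, V)]. *)
pose f (z : \bar R * \bar R) := `|z.1| * `|z.2|.
have mf : measurable_fun setT f.
  by apply: emeasurable_funM; apply: measurableT_comp.
have f0 z : 0 <= f z by rewrite mule_ge0.
transitivity (\int[pushforward mu (fun w => (U w, V w))]_z f z).
  rewrite ge0_integral_pushforward// preimage_setT.
  by apply: eq_integral => w _; rewrite /f/= !gee0_abs.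
transitivity (\int[m1 \x m2]_z f z).
  apply: eq_measure_integral => D mD _; apply/esym.
  apply: (product_measure_unique
    (m' := pushforward mu (fun w => (U w, V w)))) => //.
rewrite fubini_tonelli1//.
transitivity (\int[m1]_x (`|x| * \int[m2]_y `|y|)).
  by apply: eq_integral => x _; rewrite /fubini_F /f /= ge0_integralZl.
rewrite ge0_integralZr//; last exact: integral_ge0.
rewrite !ge0_integral_distribution//.
by congr (_ * _); apply: eq_integral => w _ /=; rewrite gee0_abs.
Qed.

Lemma emeasurable_prod d (T : measurableType d) (R : realType)
    (f : nat -> T -> \bar R) (n : nat) :
  (forall k, measurable_fun setT (f k)) ->
  measurable_fun setT (fun w => \big[*%E/1]_(k < n) f k w).
Proof.
move=> mf; elim: n => [|n IH].
  under eq_fun do rewrite big_ord0.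
  exact: measurable_cst.
under eq_fun do rewrite big_ord_recr/=.
exact: emeasurable_funM.
Qed.

(** * Expectation of a product over an independent sequence *)

Section independent_sequence.
Context d (T : measurableType d) (R : realType) (mu : probability T R).
Variable Es : nat -> T -> \bar R.
Hypothesis mEs : forall k, measurable_fun setT (Es k).
Hypothesis indEs : independent_seq mu Es.

Let tail (m n : nat) (B : nat -> set (\bar R)) : set T :=
  [set w | forall k, (m <= k < n)%N -> B k (Es k w)].

Let mpre k (B : set (\bar R)) : measurable B -> measurable (Es k @^-1` B).
Proof. by move=> mB; rewrite -[X in measurable X]setTI; exact: mEs. Qed.

Let mtail m n B : (forall k, measurable (B k)) -> measurable (tail m n B).
Proof.
move=> mB; rewrite [X in measurable X](_ : _ =
    \bigcap_(k in [set k | (m <= k < n)%N]) (Es k @^-1` B k)) //.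
by apply: bigcap_measurableType => k _; exact: mpre.
Qed.

Let tailE m n B : (m <= n)%N -> (forall k, measurable (B k)) ->
  mu (tail m n B) = \big[*%E/1]_(m <= k < n) mu (Es k @^-1` B k).
Proof.
move=> mn mB; pose B' k := if (k < m)%N then setT else B k.
(* Leaving the coordinates below [m] unconstrained reduces to the product rule, which starts at
   index 0. *)
have mB' k : measurable (B' k) by rewrite /B'; case: ifP.
have -> : tail m n B = [set w | forall k, (k < n)%N -> B' k (Es k w)].
  apply/seteqP; split=> w /= Bw k.
    by move=> kn; rewrite /B'; case: (ltnP k m) => // mk; apply: Bw; rewrite mk.
  by move=> /andP[mk kn]; have := Bw k kn; rewrite /B' ltnNge mk.
rewrite indEs// -(big_mkord xpredT (fun k => mu (Es k @^-1` B' k))).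
rewrite (big_cat_nat (leq0n m) mn)/= big_nat big1 ?mul1e; last first.
  by move=> k /= km; rewrite /B' km preimage_setT probability_setT.
by apply: eq_big_nat => k /andP[mk _]; rewrite /B' ltnNge mk.
Qed.

Variable g : \bar R -> \bar R.
Hypothesis mg : measurable_fun setT g.
Hypothesis g0 : forall y, 0 <= g y.

Let Y (m : nat) (w : T) : \bar R := \big[*%E/1]_(k < m) g (Es k w).

Let mgEs k : measurable_fun setT (g \o Es k).
Proof. exact: measurableT_comp. Qed.

Let YS m w : Y m.+1 w = Y m w * g (Es m w).
Proof. by rewrite /Y big_ord_recr. Qed.

Let mY m : measurable_fun setT (Y m).
Proof. by apply: (emeasurable_prod (f := fun k => g \o Es k)). Qed.

Let Y_ge0 m w : 0 <= Y m w.
Proof. by rewrite /Y; elim/big_ind: _ => //; exact: mule_ge0. Qed.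

(* The tail rectangle carries the induction: at step m its m-th factor is
   absorbed into the product. *)
Let Y_indep_tail m n A B : (m <= n)%N -> measurable A ->
  (forall k, measurable (B k)) ->
  mu (Y m @^-1` A `&` tail m n B) = mu (Y m @^-1` A) * mu (tail m n B).
Proof.
elim: m n A B => [|m IH] n A B mn mA mB.
  rewrite (_ : Y 0 = cst 1); last by apply/funext => w; rewrite /Y big_ord0.
  rewrite preimage_cst; case: ifPn => _.
    by rewrite setTI probability_setT mul1e.
  by rewrite set0I measure0 mul0e.
(* The induction hypothesis with a tail of length one: [Y m] is independent of [Es m]. *)
have ind1 A' B' : measurable A' -> measurable B' ->
    mu (Y m @^-1` A' `&` Es m @^-1` B') =
    mu (Y m @^-1` A') * mu (Es m @^-1` B').
  move=> mA' mB'; have -> : Es m @^-1` B' = tail m m.+1 (fun=> B').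
    apply/seteqP; split=> w /= Bw; last by apply: Bw; rewrite leqnn ltnSn.
    by move=> k; rewrite ltnS -eqn_leq => /eqP <-.
  exact: IH.
pose D := [set z : \bar R * \bar R | A (z.1 * g z.2)].
have mD : measurable D.
  have mf : measurable_fun setT (fun z : \bar R * \bar R => z.1 * g z.2).
    apply: emeasurable_funM; first exact: measurable_fst.
    by apply: measurableT_comp => //; exact: measurable_snd.
  by rewrite -[D]setTI; exact: mf.
have -> : Y m.+1 @^-1` A = (fun w => (Y m w, Es m w)) @^-1` D.
  by apply/seteqP; split=> w /=; rewrite YS.
apply: indep_pair_event => //; first exact: mtail.
(* Putting [B'] in slot [m] merges the condition on [Es m] with the tail from [m.+1] into one tail
   from [m], to which the induction hypothesis applies. *)
move=> A' B' mA' mB'; pose B2 k := if k == m then B' else B k.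
have mB2 k : measurable (B2 k) by rewrite /B2; case: ifP.
have -> : Y m @^-1` A' `&` Es m @^-1` B' `&` tail m.+1 n B =
          Y m @^-1` A' `&` tail m n B2.
  apply/seteqP; split=> w /=.
    move=> [[Aw Bw] Cw]; split=> // k /andP[mk kn]; rewrite /B2.
    by case: eqP => [->//|/eqP km]; apply: Cw; rewrite kn ltn_neqAle eq_sym km mk.
  move=> [Aw Cw]; split; [split=> //|].
    by have := Cw m; rewrite /B2 eqxx leqnn mn; exact.
  move=> k /andP[mk kn]; have := Cw k.
  by rewrite /B2 (ltnW mk) kn gtn_eqF//; exact.
rewrite IH ?(ltnW mn)// -muleA; congr (_ * _).
rewrite tailE ?(ltnW mn)// big_ltn// tailE// /B2 eqxx; congr (_ * _).
by apply: eq_big_nat => k /andP[mk _]; rewrite gtn_eqF.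
Qed.

Lemma ge0_integral_prod_indep n :
  \int[mu]_w \big[*%E/1]_(k < n) g (Es k w) =
  \big[*%E/1]_(k < n) \int[mu]_w g (Es k w).
Proof.
elim: n => [|n IH].
  under eq_integral do rewrite big_ord0.
  by rewrite big_ord0 integral_cst// mul1e; exact: probability_setT.
rewrite big_ord_recr/= -IH.
under eq_integral do rewrite big_ord_recr/=.
apply: (@ge0_integral_indepM _ _ _ mu (Y n) (g \o Es n)) => // [A B mA mB|w].
  have -> : (g \o Es n) @^-1` B = tail n n.+1 (fun=> g @^-1` B).
    apply/seteqP; split=> w /= Bw; last by apply: (Bw n); rewrite leqnn ltnSn.
    by move=> k; rewrite ltnS -eqn_leq => /eqP <-.
  by apply: Y_indep_tail => // k; rewrite -[X in measurable X]setTI; exact: mg.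
exact: g0.
Qed.

End independent_sequence.

(** * Chernoff bound *)

Section chernoff.
Context d (T : measurableType d) (R : realType) (mu : probability T R).
Variable Es : nat -> T -> \bar R.
Hypothesis mEs : forall k, measurable_fun setT (Es k).
Hypothesis indEs : independent_seq mu Es.
Hypothesis Es_pos : {ae mu, forall w, forall k, 0 < Es k w < +oo}.

(** The product of the tilts is [exp (n s c)] times the power [- s] of the wealth; the real exponent
    [y], the log-wealth, replaces powers of extended reals. *)
Lemma prod_tilt (e : nat -> \bar R) (c s : R) (n : nat) :
  (forall k, 0 < e k < +oo) ->
  exists2 y : R, \big[*%E/1]_(k < n) e k = (expR y)%:E &
    \big[*%E/1]_(k < n) tilt c s (e k) = (expR (n%:R * (s * c) - s * y))%:E.
Proof.
move=> e0; elim: n => [|n [y IH1 IH2]].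
  by exists 0%R; rewrite !big_ord0 ?expR0// mul0r mulr0 subr0 expR0.
have : exists z, e n = (expR z)%:E.
  have := e0 n; case: (e n) => [r /andP[r0 _]|/andP[]//|/andP[]//].
  by exists (ln r); rewrite lnK// posrE -lte_fin.
case=> z ez; exists (y + z)%R.
  by rewrite big_ord_recr/= IH1 ez expRD EFinM.
rewrite big_ord_recr/= IH2 ez /tilt lne_EFin ?expR_gt0// expRK -EFinM -expRD.
by congr (expR _)%:E; rewrite -natr1; ring.
Qed.

Lemma measurable_wealth_le (t : nat) (y : \bar R) :
  measurable [set w | wealth Es t w <= y].
Proof.
rewrite -[X in measurable X]setTI; apply: emeasurable_fun_infty_c => //.
exact: emeasurable_prod.
Qed.

(** Markov's inequality for the product of the tilts, whose integral is at most [exp (t p)] by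
    independence. *)
Lemma gamma_chernoff (c s p alpha : R) (t : nat) : (0 < alpha)%R -> (0 <= s)%R ->
  (forall k, \int[mu]_w tilt c s (Es k w) <= (expR p)%:E) ->
  gamma mu Es t alpha <=
  (expR (t%:R * p - t%:R * (s * c) + s * ln alpha^-1))%:E.
Proof.
move=> a0 s0 Ip; set l := ln alpha^-1.
have mt := measurable_tilt c s.
have mG := measurable_wealth_le t (alpha^-1)%:E.
(* A lower bound for the product of the tilts where the log-wealth is at most [l], since
   [s >= 0]. *)
pose M := expR (t%:R * (s * c) - s * l).
have MG : M%:E * gamma mu Es t alpha <=
          \int[mu]_w \big[*%E/1]_(k < t) tilt c s (Es k w).
  rewrite /gamma -[X in mu X]setIT -integral_indic// -ge0_integralZl//; last 2 first.
  - by apply/measurable_EFinP.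
  - by rewrite lee_fin expR_ge0.
  apply: ae_ge0_le_integral => //.
  - by move=> w _; rewrite mule_ge0// lee_fin ?expR_ge0.
  - by apply: emeasurable_funM => //; apply/measurable_EFinP.
  - by move=> w _; elim/big_ind: _ => //; [exact: mule_ge0|move=> k _; exact: tilt_ge0].
  - by apply: (emeasurable_prod (f := fun k => tilt c s \o Es k)) => k; exact: measurableT_comp.
  apply: filterS Es_pos => w wpos _.
  have [y Wy ->] := prod_tilt c s t wpos.
  rewrite indicE; have [|_] := boolP (w \in _); last by rewrite mule0 lee_fin expR_ge0.
  rewrite inE /= /wealth Wy lee_fin => yl; rewrite mule1 lee_fin ler_expR.
  rewrite lerD2l lerN2 ler_wpM2l// /l -[y]expRK ler_ln// posrE ?expR_gt0//.
  by rewrite invr_gt0.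
have Ipt : \int[mu]_w \big[*%E/1]_(k < t) tilt c s (Es k w) <= (expR (t%:R * p))%:E.
  rewrite (ge0_integral_prod_indep mEs indEs mt)//; last exact: tilt_ge0.
  elim: t {mG M MG} => [|t IH]; first by rewrite big_ord0 mul0r expR0.
  rewrite big_ord_recr/= -natr1 mulrDl mul1r expRD EFinM; apply: lee_pmul => //.
    elim/big_ind: _ => // [|k _]; first exact: mule_ge0.
    by apply: integral_ge0 => w _; exact: tilt_ge0.
  by apply: integral_ge0 => w _; exact: tilt_ge0.
have /(le_trans MG) := Ipt.
have : gamma mu Es t alpha \is a fin_num by exact: fin_num_measure.
case: (gamma mu Es t alpha) => [r _|//|//]; rewrite -EFinM !lee_fin.
rewrite -ler_pdivlMl ?expR_gt0// -expRN -expRD => /le_trans; apply.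
by rewrite ler_expR; lra.
Qed.

End chernoff.

(** * Rate function *)

Section rate_function.
Context (R : realType) (smax : \bar R) (psi : R -> \bar R).
Hypothesis smax_gt0 : 0 < smax.
Hypothesis psi0 : psi 0%R = 0.
Hypothesis psi_ge0 : forall s, sdom smax s -> 0 <= psi s.

Lemma sdom0 : sdom smax 0%R.
Proof. by split. Qed.

Lemma sdom_le (s u : R) : sdom smax s -> (0 <= u <= s)%R -> sdom smax u.
Proof.
move=> [_ ss] /andP[u0 us]; split=> //.
by apply: le_lt_trans ss; rewrite lee_fin.
Qed.

Lemma le_rate (x s : R) : sdom smax s -> (s * x)%:E - psi s <= rate smax psi x.
Proof. by move=> ds; apply: ereal_sup_ubound; exists s. Qed.

Lemma rate_le (x : R) (y : \bar R) :
  (forall s, sdom smax s -> (s * x)%:E - psi s <= y) -> rate smax psi x <= y.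
Proof. by move=> H; apply: ge_ereal_sup => _ [s ds <-]; exact: H. Qed.

Lemma rate_ge0 (x : R) : 0 <= rate smax psi x.
Proof. by have := le_rate x sdom0; rewrite mul0r psi0 sube0. Qed.

Lemma rate_at0 : rate smax psi 0%R = 0.
Proof.
apply/eqP; rewrite eq_le rate_ge0 andbT; apply: rate_le => s ds.
by rewrite mulr0 sub0e oppe_le0 psi_ge0.
Qed.

Lemma maximiser_superdifferential (c s : R) :
  maximiser smax psi c s -> superdifferential smax psi c s.
Proof.
move=> [ds sE] x x0; apply: le_trans (le_rate x ds).
rewrite -sE; have := psi_ge0 ds; case: (psi s) => [p _|_|//].
  by rewrite -!EFinB -EFinD lee_fin; lra.
(* If [psi s] were infinite, the rate at [c] would be [-oo] and the inequality trivial. *)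
by rewrite addeNy leNye.
Qed.

(* The slope is the supremum of the slopes from (s, a) to the points of the
   graph on its left; lower semicontinuity makes it finite, and convexity makes
   the line stay below psi on the right of s. *)
Lemma convex_support_line (s a : R) :
  convex_on_sdom smax psi -> lsc_on_sdom smax psi ->
  sdom smax s -> a%:E < psi s ->
  exists2 x : R, (0 <= x)%R &
    forall u, sdom smax u -> (x * (u - s) + a)%:E <= psi u.
Proof.
move=> cvx lsc ds apsi; have [a0|a0] := ltP a 0%R.
  exists 0%R => // u du; rewrite mul0r add0r; apply: le_trans (psi_ge0 du).
  by rewrite lee_fin ltW.
have s0 : (0 < s)%R.
  rewrite lt0r ds.1 andbT; apply: contraTneq apsi => ->.
  by rewrite psi0 lte_fin -leNgt.
have [e /= e0 lsce] := lsc s a ds apsi.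
pose S := [set y : R | exists u q : R,
  [/\ (0 <= u < s)%R, psi u = q%:E & y = ((a - q) / (s - u))%R]].
(* Within [e] of [s], [psi] exceeds [a] and the slope is at most 0; farther away, [q >= 0] and
   [s - u >= e] bound it. *)
have Sub : ubound S (a / e)%R.
  move=> _ [u [q [/andP[u0 us] uq ->]]].
  have du : sdom smax u by apply: sdom_le ds _; rewrite u0 ltW.
  have su : (0 < s - u)%R by rewrite subr_gt0.
  have [sue|sue] := ltP (s - u)%R e.
    have : a%:E < psi u by apply: lsce => //=; rewrite gtr0_norm.
    rewrite uq lte_fin => aq; apply: (@le_trans _ _ 0%R).
      by rewrite ler_pdivrMr// mul0r subr_le0 ltW.
    by rewrite divr_ge0// ltW.
  have := psi_ge0 du; rewrite uq lee_fin => q0.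
  apply: (@le_trans _ _ (a / (s - u))%R).
    by rewrite ler_pM2r ?invr_gt0// gerBl.
  by rewrite ler_wpM2l// lef_pV2// posrE.
(* The slope from the point [(0, 0)] of the graph; it makes the supremum nonnegative. *)
have S0 : S (a / s)%R.
  by exists 0%R, 0%R; rewrite lexx s0 !subr0.
have hS : has_sup S by split; [exists (a / s)%R|exists (a / e)%R].
exists (sup S).
  by apply: le_trans (ub_le_sup hS.2 S0); rewrite divr_ge0// ltW.
move=> u du; have := psi_ge0 du.
case psiu: (psi u) => [p||//]; last by move=> _; exact: leey.
rewrite !lee_fin => p0; have [us|us|us] := ltgtP u s.
- have : S ((a - p) / (s - u))%R by exists u, p; rewrite us du.1.
  move=> /(ub_le_sup hS.2); rewrite ler_pdivrMr ?subr_gt0//.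
  by lra.
- suff : (sup S <= (p - a) / (u - s))%R by rewrite ler_pdivlMr ?subr_gt0//; lra.
  apply: ge_sup; first by exists (a / s)%R.
  move=> _ [v [q [/andP[v0 vs] vq ->]]].
  have dv : sdom smax v by apply: sdom_le ds _; rewrite v0 ltW.
  have uv : (0 < u - v)%R by lra.
  (* The weight that places [s] on the segment from [v] to [u]. Convexity gives
     [a < (1 - l) q + l p], which rearranges into the comparison of the slopes on the two sides of
     [s]. *)
  pose l := ((s - v) / (u - v))%R.
  have luv : (l * (u - v) = s - v)%R by rewrite /l divfK// gt_eqF.
  have l01 : (0 <= l <= 1)%R.
    apply/andP; split; first by apply: divr_ge0; lra.
    by rewrite ler_pdivrMr// mul1r; lra.
  have := cvx v u l dv du l01.
  have -> : ((1 - l) * v + l * u = s)%R by lra.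
  rewrite vq psiu -!EFinM -EFinD => /(lt_le_trans apsi); rewrite lte_fin => al.
  rewrite ler_pdivrMr ?subr_gt0// mulrAC ler_pdivlMr ?subr_gt0//.
  have : (a * (u - v) <= ((1 - l) * q + l * p) * (u - v))%R.
    by rewrite ler_wpM2r// ltW.
  have -> : (((1 - l) * q + l * p) * (u - v) =
    (u - v - l * (u - v)) * q + (l * (u - v)) * p)%R by ring.
  by rewrite luv; lra.
- by move: apsi; rewrite -us psiu lte_fin subrr mulr0 add0r => /ltW.
Qed.

(** Biconjugation at [s]: a line of slope [x] through [(s, a)] below [psi] gives
    [psi* x <= x s - a], and the slope inequality at [x] turns this into [a <= s c - psi* c]. Then
    [a] increases to [psi s]. *)
Lemma superdifferential_maximiser (c s : R) :
  convex_on_sdom smax psi -> lsc_on_sdom smax psi ->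
  sdom smax s -> superdifferential smax psi c s -> maximiser smax psi c s.
Proof.
move=> cvx lsc ds sd; split=> //; apply/eqP; rewrite eq_le le_rate//=.
(* The slope inequality at 0, where the rate vanishes, rules out an infinite rate at [c]. *)
have := sd 0%R (lexx _); rewrite rate_at0.
have := rate_ge0 c; case rc: (rate smax psi c) => [r|//|//] r0 _.
have key a : a%:E < psi s -> (a <= s * c - r)%R.
  move=> /(convex_support_line cvx lsc ds)[x x0 sx].
  have : rate smax psi x <= (x * s - a)%:E.
    apply: rate_le => u du; have := sx u du.
    case: (psi u) => [p|_|//]; last by rewrite addeNy leNye.
    by rewrite -EFinB !lee_fin; lra.
  move=> /(le_trans (sd x x0)); rewrite rc -EFinD lee_fin; lra.
have := psi_ge0 ds; case: (psi s) key => [p|key _|//].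
  move=> key _; rewrite -EFinB lee_fin; apply/ler_addgt0Pr => e e0.
  have := key (p - e)%R; rewrite lte_fin ltrBlDr ltrDl => /(_ e0); lra.
(* An infinite [psi s] would admit every real [a], even one beyond the bound. *)
by exfalso; have := key (s * c - r + 1)%R; rewrite ltry => /(_ isT); lra.
Qed.

End rate_function.

(** * Optimised Chernoff bound and slopes of the rate function *)

Section chernoff_rate.
Context d (T : measurableType d) (R : realType) (mu : probability T R).
Variable Es : nat -> T -> \bar R.
Hypothesis mEs : forall k, measurable_fun setT (Es k).
Hypothesis indEs : independent_seq mu Es.
Hypothesis Es_pos : {ae mu, forall w, forall k, 0 < Es k w < +oo}.
Variables (smax : \bar R) (psi : R -> \bar R) (c : R).
Hypothesis smax_gt0 : 0 < smax.
Hypothesis psi0 : psi 0%R = 0.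
Hypothesis psi_ge0 : forall s, sdom smax s -> 0 <= psi s.
Hypothesis psi_maj : forall k s, sdom smax s ->
  lne (\int[mu]_w tilt c s (Es k w)) <= psi s.

Lemma gamma_superdifferential (t : nat) (alpha sigma : R) :
  (0 < alpha < 1)%R -> (ln alpha^-1 <= t%:R * c)%R ->
  superdifferential smax psi c sigma ->
  gamma mu Es t alpha <=
  expeR (- (t%:R%:E * rate smax psi c) + (sigma * ln alpha^-1)%:E).
Proof.
move=> /andP[a0 a1] ltc sd; set l := ln alpha^-1 in ltc *.
have l0 : (0 < l)%R by rewrite ln_gt0// invf_gt1.
have t0 : (0 < t%:R :> R)%R.
  rewrite ltr0n; case: t ltc => // ltc.
  by move: (lt_le_trans l0 ltc); rewrite mul0r ltxx.
set G := gamma _ _ _ _.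
have : 0 <= G by exact: measure_ge0.
(* Once the null case is removed, the probability has a real logarithm [u]. *)
rewrite le_eqVlt => /predU1P[<-|G0]; first exact: expeR_ge0.
have [g Gg] : exists g, G = g%:E.
  by exists (fine G); rewrite fineK//; apply: fin_num_measure; exact: measurable_wealth_le.
have g0 : (0 < g)%R by rewrite -lte_fin -Gg.
rewrite Gg.
have [u gu] : exists u, g = expR u by exists (ln g); rewrite lnK.
(* The level per step absorbing the threshold: the Chernoff exponent becomes [- t (s x - psi s)].
   The assumption [l <= t c] is exactly [x >= 0]. *)
pose x := (c - l / t%:R)%R.
have tx : (t%:R * x = t%:R * c - l)%R.
  by rewrite /x mulrBr mulrCA divff ?mulr1// gt_eqF.
have x0 : (0 <= x)%R by rewrite -(pmulr_rge0 _ t0) tx subr_ge0.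
have xc : (t%:R * (x - c) = - l)%R by rewrite mulrBr tx; lra.
(* Optimising over [s] means that every Chernoff bound gives one upper bound on the objective at
   [x]. *)
have rx : rate smax psi x <= (- u / t%:R)%:E.
  apply: rate_le => s ds; have := psi_ge0 ds; case psis : (psi s) => [p||//].
    move=> _; rewrite -EFinB lee_fin ler_pdivlMr// lerNr.
    have Ip k : \int[mu]_w tilt c s (Es k w) <= (expR p)%:E.
      have := psi_maj k ds; rewrite psis -lee_expeR lneK//.
      by rewrite in_itv/= leey andbT; apply: integral_ge0 => w _; exact: tilt_ge0.
    have := gamma_chernoff mEs indEs Es_pos t a0 ds.1 Ip.
    rewrite -/G Gg gu lee_fin ler_expR -/l => /le_trans; apply.
    have -> : ((s * x - p) * t%:R = s * (t%:R * x) - t%:R * p)%R by ring.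
    by rewrite tx; lra.
  by move=> _; rewrite addeNy leNye.
have := le_trans (sd x x0) rx.
have := rate_ge0 smax_gt0 psi0 c.
case: (rate smax psi c) => [r _|//|//].
rewrite -EFinD lee_fin ler_pdivlMr// => rt.
rewrite -EFinM -EFinN -EFinD /= lee_fin gu ler_expR.
have : ((r + sigma * (x - c)) * t%:R = t%:R * r + sigma * (t%:R * (x - c)))%R by ring.
by rewrite xc; lra.
Qed.

End chernoff_rate.

Lemma powR_expeR (R : realType) (alpha sigma : R) (y : \bar R) :
  (0 < alpha)%R ->
  (alpha `^ (- sigma))%:E * expeR y = expeR (y + (sigma * ln alpha^-1)%:E).
Proof.
move=> a0; rewrite expeRD muleC; congr (_ * _)%E.
by rewrite /powR gt_eqF// lnV ?posrE//= mulrN mulNr.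
Qed.

(** The limit of difference quotients yields only a weak inequality. It is applied at the midpoint
    of [u] and [v], where strict convexity then gives strictness at [v]. *)
Lemma strictly_convex_tangent (R : realType) (D : set R) (f : R -> R) (u v : R) :
  (forall x y l : R, D x -> D y -> (0 < l < 1)%R -> D ((1 - l) * x + l * y)%R) ->
  strictly_convex_on D f -> D u -> D v -> v <> u -> derivable f u 1 ->
  (f u + derive1 f u * (v - u) < f v)%R.
Proof.
move=> cvxD cvx Du Dv vu df; set L : R := derive1 f u.
have weak w : D w -> w <> u -> (f u + L * (w - u) <= f w)%R.
  move=> Dw wu; have wu0 : (0 < `|w - u|)%R.
    by rewrite normr_gt0 subr_eq0; exact/eqP.
  apply/ler_addgt0Pr => e e0; pose e' : R := (e / `|w - u|)%R.
  have e'0 : (0 < e')%R by rewrite divr_gt0.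
  have : h^-1 *: ((f \o shift u) (h *: 1%R) - f u) @[h --> 0%R^'] --> L.
    by rewrite /L derive1E; exact: df.
  move=> /cvgrPdist_lt/(_ _ e'0); rewrite /= => -[r /= r0 Hr].
  (* Small enough for [k < 1], a convex weight, and for the increment [k (w - u)] to be within the
     radius [r] of the difference quotient estimate. *)
  pose k := (Num.min 2^-1 (r / `|w - u| / 2))%R.
  have k0 : (0 < k)%R by rewrite lt_min invr_gt0 ltr0n/= divr_gt0// divr_gt0.
  have k1 : (k < 1)%R by rewrite gt_min; apply/orP; left; lra.
  have kr : (k * `|w - u| < r)%R.
    rewrite -ltr_pdivlMr// gt_min; apply/orP; right.
    by have : (0 < r / `|w - u|)%R by [rewrite divr_gt0|]; lra.
  have kwu : (k * (w - u) != 0)%R by rewrite mulf_neq0//; [rewrite gt_eqF|rewrite subr_eq0; exact/eqP].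
  have := Hr (k * (w - u))%R.
  rewrite /= sub0r normrN normrM gtr0_norm// => /(_ kr kwu).
  rewrite /GRing.scale/= mulr1 => H.
  have := cvx u w k Du Dw; rewrite k0 k1 => /(_ (fun E => wu (esym E)) isT).
  have -> : ((1 - k) * u + k * w = k * (w - u) + u)%R by ring.
  set F := f (_ + _)%R in H * => FF.
  have : (`|L * (k * (w - u)) - (F - f u)| <= e * k)%R.
    have -> : (L * (k * (w - u)) - (F - f u) =
      (L - (k * (w - u))^-1 * (F - f u)) * (k * (w - u)))%R.
      by field; move: kwu; rewrite mulf_eq0 negb_or andbC.
    rewrite (normrM (L - _)%R) (normrM k) (gtr0_norm k0).
    have -> : (e * k = e' * (k * `|w - u|))%R.
      by rewrite /e'; field; rewrite gt_eqF.
    by rewrite ler_wpM2r ?ltW// mulr_gt0.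
  rewrite ler_norml => /andP[_ H2].
  have : (k * (L * (w - u)) <= k * (f w - f u + e))%R by lra.
  by rewrite ler_pM2l//; lra.
pose w : R := ((1 - 2^-1) * u + 2^-1 * v)%R.
have h01 : (0 < (2^-1 : R) < 1)%R by apply/andP; split; lra.
have Dw : D w by exact: cvxD.
have wu : w <> u by move=> wu; apply: vu; move: wu; rewrite /w; lra.
have := weak w Dw wu; have := cvx u v 2^-1%R Du Dv (fun E => vu (esym E)) h01.
rewrite -/w.
have -> : (w - u = 2^-1 * (v - u))%R by rewrite /w; lra.
have -> : (L * (2^-1 * (v - u)) = 2^-1 * (L * (v - u)))%R by ring.
lra.
Qed.

(** * Special majorants *)

Section strictly_convex_majorant.
Context (R : realType) (smax : \bar R) (psi : R -> \bar R) (c : R).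
Hypothesis smax_gt0 : 0 < smax.
Hypothesis psi0 : psi 0%R = 0.
Hypothesis psi_ge0 : forall s, sdom smax s -> 0 <= psi s.
Hypothesis psi_fin : forall s, sdom_int smax s -> psi s \is a fin_num.
Let f : R -> R := fun s => fine (psi s).
Hypothesis df : forall s, sdom_int smax s -> derivable f s 1.
Hypothesis cvxf : strictly_convex_on (sdom_int smax) f.

Lemma sdom_intW (s : R) : sdom_int smax s -> sdom smax s.
Proof. by case=> s0 ss; split=> //; exact: ltW. Qed.

Let intE s : sdom_int smax s -> psi s = (f s)%:E.
Proof. by move=> /psi_fin; rewrite /f => /fineK ->. Qed.

Lemma sdom_int_convex (x y l : R) : sdom_int smax x -> sdom_int smax y ->
  (0 < l < 1)%R -> sdom_int smax ((1 - l) * x + l * y)%R.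
Proof.
move=> [x0 xs] [y0 ys] /andP[l0 l1]; split.
  by rewrite addr_gt0// mulr_gt0// subr_gt0.
have m : ((1 - l) * x + l * y <= Num.max x y)%R.
  have : ((1 - l) * x <= (1 - l) * Num.max x y)%R.
    by rewrite ler_wpM2l ?subr_ge0 ?(ltW l1)// le_max lexx.
  have : (l * y <= l * Num.max x y)%R.
    by rewrite ler_wpM2l ?(ltW l0)// le_max lexx orbT.
  by lra.
apply: (@le_lt_trans _ _ (Num.max x y)%:E); first by rewrite lee_fin.
by case: (leP x y).
Qed.

Let tangent u v : sdom_int smax u -> sdom_int smax v -> v <> u ->
  (f u + derive1 f u * (v - u) < f v)%R.
Proof.
move=> Du Dv vu.
by apply: (strictly_convex_tangent (@sdom_int_convex)) => //; exact: df.
Qed.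

(** Fermat's rule for [c t - f t] on a bounded open interval []0, b[] around [s]; a real [b] is
    chosen because [smax] may be infinite. *)
Lemma derive1_maximiser_eq (s : R) : (0 < s)%R -> maximiser smax psi c s ->
  derive1 f s = c.
Proof.
move=> s0 [ds sE].
have [b sb bs] : exists2 b : R, (s < b)%R & b%:E <= smax.
  have := ds.2; case: smax => [r rs|_|//]; first by exists r.
  by exists (s + 1)%R; rewrite ?ltrDl ?leey.
have Di t : t \in `]0%R, b[ -> sdom_int smax t.
  rewrite in_itv/= => /andP[t0 tb]; split=> //.
  by apply: lt_le_trans bs; rewrite lte_fin.
have si : s \in `]0%R, b[ by rewrite in_itv/= s0.
pose g (t : R) : R := (c * t - f t)%R.
have dg t : t \in `]0%R, b[ -> is_derive t 1%R g (c - derive1 f t)%R.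
  move=> /Di/df dft; have := derivableP dft; rewrite -derive1E => Hf.
  have Hc : is_derive t (1%R : R) ( *%R c : R -> R) c.
    have := @is_deriveZ _ _ _ id c t 1%R _ (is_derive_id t 1%R).
    by move=> /is_derive_eq; apply; rewrite /GRing.scale/= mulr1.
  by have := is_deriveB Hc Hf.
have g0 : is_derive s 1%R g 0%R.
  apply: (@derive1_at_max _ g 0%R b) => //.
  - by rewrite ltW// (lt_trans s0).
  - by move=> t ti; have [] := dg t ti.
  - move=> t ti; have := le_rate psi c (sdom_intW (Di t ti)).
    by rewrite -sE (intE (Di t ti)) (intE (Di s si)) -!EFinB lee_fin /g ![(c * _)%R]mulrC.
have [_ e1] := dg s si; have [_ e2] := g0.
by move: e1; rewrite e2 => /esym/eqP; rewrite subr_eq0 => /eqP.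
Qed.

(** For distinct points of common slope [c], the two strict tangent inequalities would contradict
    each other. *)
Lemma derive1_eq_maximiser (s u : R) : (0 < s)%R -> maximiser smax psi c s ->
  sdom_int smax u -> derive1 f u = c -> u = s.
Proof.
move=> s0 ms Du fu; apply: contrapT => us.
have Ds : sdom_int smax s by split=> //; case: ms => [[]].
have := tangent Ds Du us; have := tangent Du Ds (fun E => us (esym E)).
by rewrite (derive1_maximiser_eq s0 ms) fu; lra.
Qed.

(** The tangent at [u] handles the interior competitors. The endpoint 0 is handled by the limit of
    [f] there, which matches [psi 0 = 0]. *)
Lemma derive1_maximiser_unique (u : R) :
  f s @[s --> at_right (0%R : R)] --> (0%R : R) ->
  sdom_int smax u -> derive1 f u = c ->
  maximiser smax psi c u /\ forall s, maximiser smax psi c s -> s = u.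
Proof.
move=> f0 Du fu; have u0 := Du.1.
have f_ge0 v : sdom_int smax v -> (0 <= f v)%R.
  by move=> Dv; rewrite -lee_fin -intE// psi_ge0//; exact: sdom_intW.
(* The objective at [u] strictly beats its value 0 at the endpoint. Otherwise the tangent inequality
   at [h = u / 2] gives [f h > f u / 2]; but for [v] near 0, [h] lies between [v] and [u] with
   weight [l <= 1/2] on [u], so [f h < f v + f u / 2] with [f v] arbitrarily small. *)
have ucfu : (f u < u * c)%R.
  rewrite ltNge; apply/negP => cfu.
  pose h : R := (u / 2)%R.
  have Dh : sdom_int smax h.
    split; first by rewrite /h; lra.
    by apply: le_lt_trans Du.2; rewrite lee_fin /h; lra.
  have hu : h <> u by rewrite /h; lra.
  have := tangent Du Dh hu; rewrite fu => th.
  pose e : R := (f h - f u / 2)%R.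
  have e0 : (0 < e)%R.
    rewrite /e; have : (c * (h - u) = - (u * c) / 2)%R by rewrite /h; field.
    by lra.
  have [v [/andP[v0 vh] fve]] : exists v : R, (0 < v < h)%R /\ (f v < e)%R.
    have h0 := Dh.1.
    near (at_right (0 : R)) => v; exists v; split.
      by apply/andP; split; near: v; [exact: nbhs_right_gt|exact: nbhs_right_lt].
    have : (`|0 - f v| < e)%R.
      by near: v; move/cvgrPdist_lt : f0; exact.
    by rewrite sub0r normrN; exact/le_lt_trans/ler_norm.
  have Dv : sdom_int smax v.
    by split=> //; apply: lt_trans Dh.2; rewrite lte_fin.
  have uv : (0 < u - v)%R by move: vh; rewrite /h; lra.
  pose l : R := ((h - v) / (u - v))%R.
  have luv : (l * (u - v) = h - v)%R by rewrite /l divfK// gt_eqF.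
  have l0 : (0 < l)%R by rewrite divr_gt0// subr_gt0.
  have l1 : (l <= 2^-1)%R by rewrite ler_pdivrMr// /h; lra.
  have l01 : (0 < l < 1)%R by rewrite l0/=; lra.
  have := cvxf Dv Du (_ : v <> u) l01.
  have -> : ((1 - l) * v + l * u = h)%R by lra.
  have vu : v <> u by lra.
  move=> /(_ vu).
  have : ((1 - l) * f v <= f v)%R.
    by rewrite ler_piMl ?f_ge0//; lra.
  have : (l * f u <= 2^-1 * f u)%R by rewrite ler_wpM2r// f_ge0.
  by move: fve; rewrite /e; lra.
have mu : maximiser smax psi c u.
  split; first exact: sdom_intW.
  apply/eqP; rewrite eq_le le_rate ?andTb; last exact: sdom_intW.
  apply: rate_le => v [v0 vs]; rewrite (intE Du) -EFinB.
  move: v0; rewrite le_eqVlt => /predU1P[<-|v0].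
    by rewrite psi0 sube0 lee_fin mul0r subr_ge0 ltW.
  rewrite (intE (conj v0 vs)) -EFinB lee_fin.
  have [->//|/eqP vu] := eqVneq v u.
  by have := tangent Du (conj v0 vs) vu; rewrite fu; lra.
split=> // s ms; apply: contrapT => su.
have := ms.1.1; rewrite le_eqVlt => /predU1P[s0|s0].
  have := ms.2; rewrite -mu.2 -s0 psi0 sube0 mul0r (intE Du) -EFinB => -[].
  by lra.
by apply: su; apply/esym; exact: derive1_eq_maximiser.
Unshelve. all: by end_near. Qed.

End strictly_convex_majorant.

(** * The chord majorant *)

Section chord_majorant.
Context (R : realType) (psi : R -> \bar R) (s0 rho c : R).
Hypothesis s0_gt0 : (0 < s0)%R.
Hypothesis psiE : forall s : R, (0 <= s)%R ->
  psi s = if (s <= s0)%R then (s / s0 * (ln rho + s0 * c))%:E else +oo.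

(** The terms in [c] cancel, leaving a linear function of [s] whose direction depends only on
    whether [rho] is below or above 1. *)
Lemma chord_objective (s : R) : (0 <= s <= s0)%R ->
  (s * c)%:E - psi s = (- (s / s0 * ln rho))%:E.
Proof.
move=> /andP[s_ge0 ss]; rewrite psiE// ss -EFinB; congr (_%:E).
by field; rewrite gt_eqF.
Qed.

Lemma chord_objective_out (s : R) : (s0 < s)%R -> (s * c)%:E - psi s = -oo.
Proof.
by move=> ss; rewrite psiE ?(ltW (lt_trans s0_gt0 ss))// leNgt ss.
Qed.

Let s0_in : (0 <= s0 <= s0)%R. Proof. by rewrite ltW/=. Qed.

Lemma chord_maximiser : (0 < rho)%R -> (rho <= 1)%R -> maximiser +oo psi c s0.
Proof.
move=> rho0 rho1; have ds0 : sdom +oo s0 by split; rewrite ?ltry ?ltW.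
split=> //; apply/eqP; rewrite eq_le le_rate//=.
apply: rate_le => s [s_ge0 _].
have [ss|ss] := leP s s0; last by rewrite chord_objective_out// leNye.
rewrite (chord_objective s0_in) chord_objective ?s_ge0// lee_fin.
rewrite divff ?gt_eqF// -!mulrN ler_wpM2r ?oppr_ge0 ?ln_le0//.
by rewrite ler_pdivrMr// mul1r.
Qed.

Lemma chord_maximiser_unique (s : R) : (0 < rho)%R -> (rho < 1)%R ->
  maximiser +oo psi c s -> s = s0.
Proof.
move=> rho0 rho1 [[s_ge0 _] sE].
have [_ s0E] := chord_maximiser rho0 (ltW rho1).
have [ss|ss] := leP s s0; last first.
  by move: sE; rewrite chord_objective_out// -s0E chord_objective.
move: sE; rewrite -s0E (chord_objective s0_in) chord_objective ?s_ge0// => -[] /oppr_inj.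
rewrite divff ?gt_eqF// => /mulIf.
rewrite lt_eqF ?ln_lt0 ?rho0// => /(_ isT) e.
by rewrite -[s](divfK (lt0r_neq0 s0_gt0)) e mul1r.
Qed.

Lemma chord_rate_le0 : (1 <= rho)%R -> rate +oo psi c <= 0.
Proof.
move=> rho1; apply: rate_le => s [s_ge0 _].
have [ss|ss] := leP s s0; last by rewrite chord_objective_out// leNye.
rewrite chord_objective ?s_ge0// lee_fin oppr_le0 mulr_ge0 ?ln_ge0//.
by rewrite divr_ge0// ltW.
Qed.

End chord_majorant.

(** * The i.i.d. observations *)

Lemma lne_fin_num (R : realType) (e : \bar R) :
  (lne e \is a fin_num) = (0 < e < +oo).
Proof.
case: e => [r| |] //=; last by rewrite ltxx andbF.
by rewrite ltry andbT lte_fin; case: (leP r 0%R).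
Qed.

(** A finite difference forces both parts to have finite integrals, hence [f] is integrable. *)
Lemma ae_fin_num_integral d (T : measurableType d) (R : realType)
    (mu : {measure set T -> \bar R}) (f : T -> \bar R) :
  measurable_fun setT f -> \int[mu]_x f x \is a fin_num ->
  {ae mu, forall x, f x \is a fin_num}.
Proof.
move=> mf; rewrite integralE fin_numB => /andP[fp fn].
have /integrable_ae : mu.-integrable setT f.
  apply/integrableP; split=> //.
  rewrite (eq_integral (fun x => f^\+ x + f^\- x)); last first.
    by move=> x _; rewrite -/((abse \o f) x) fune_abse.
  rewrite ge0_integralD//; last 2 first.
  - exact: measurable_funepos.
  - exact: measurable_funeneg.
  by rewrite lte_add_pinfty// ltey_eq ?fp ?fn.
by move=> /(_ measurableT); apply: filterS => x; exact.
Qed.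

Section observations.
Context d (X : measurableType d).

Lemma past_measurable (n : nat) (A : set (seqspace X)) :
  past X n A -> measurable A.
Proof.
apply: sub_sigma_algebra2 => _ [k [B [_ mB ->]]].
by exists k, B.
Qed.

Lemma measurable_wrt_cst T (R : realType) (G : set (set T)) (y : \bar R) :
  sigma_algebra setT G -> measurable_wrt G (cst y).
Proof.
move=> [G0 GC _] B mB; rewrite preimage_cst; case: ifPn => _ //.
by rewrite -[setT](setD0); exact: GC.
Qed.

Context (R : realType) (P1 : probability X R) (E : X -> \bar R).
Context (PP1 : probability (seqspace X) R) (Es : nat -> seqspace X -> \bar R).
Hypothesis mE : measurable_fun setT E.
Hypothesis mEs : forall k, measurable_fun setT (Es k).
Hypothesis Es_iid : iid_as P1 E PP1 Es.

Lemma iid_integral_tilt (c s : R) (k : nat) :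
  \int[PP1]_w tilt c s (Es k w) = \int[P1]_x tilt c s (E x).
Proof.
rewrite (ge0_integral_indep (P := P1) (E := E)) => //.
- by rewrite -[RHS]mul1e; congr (_ * _); exact: probability_setT.
- move=> B mB; rewrite setTI Es_iid.2// -[LHS]mul1e; congr (_ * _).
  by apply/esym; exact: probability_setT.
- exact: measurable_tilt.
- exact: tilt_ge0.
Qed.

Variable c : R.
Hypothesis cE : \int[P1]_x lne (E x) = c%:E.

(** A finite mean makes [lne E] finite almost surely; equality of laws transfers this to each
    factor, and countably many null sets are discarded. *)
Lemma iid_ae_pos : {ae PP1, forall w, forall k, 0 < Es k w < +oo}.
Proof.
apply: ae_foralln => k.
have mlne : measurable_fun setT (@lne R).
  by apply: nondecreasing_emeasurable; exact: le_lne.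
have : {ae P1, forall x, (@lne R \o E) x \is a fin_num}.
  apply: ae_fin_num_integral; first exact: measurableT_comp.
  by rewrite /= cE.
pose B := [set e : \bar R | ~ 0 < e < +oo].
have mB : measurable B.
  have -> : B = [set` `]-oo, 0]] `|` [set +oo].
    apply/seteqP; split=> e; rewrite /B /= in_itv/=.
      move=> /negP; rewrite negb_and -!leNgt leye_eq.
      by move=> /orP[|/eqP]; [left|right].
    move=> [e0|->]; last by rewrite ltxx andbF.
    by move=> /andP[]; rewrite ltNge e0.
  by apply: measurableU => //; exact: emeasurable_itv.
move=> /negligibleP; rewrite (_ : ~` _ = E @^-1` B); last first.
  by apply/seteqP; split=> x; rewrite /B /= lne_fin_num.
have mEB : measurable (E @^-1` B) by rewrite -[X in measurable X]setTI; exact: mE.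
move=> /(_ mEB) EB0; exists (Es k @^-1` B); split=> //.
  by rewrite -[X in measurable X]setTI; exact: mEs.
by rewrite -EB0; apply: Es_iid.2.
Qed.

(** Independence of the past makes the constant expectations versions of the conditional ones. *)
Lemma iid_homogeneous_aggregate (smax : \bar R) (psi : R -> \bar R) :
  majorant P1 E c smax psi -> independent_of_past PP1 Es ->
  homogeneous_aggregate PP1 Es c smax psi.
Proof.
move=> [_ _ maj] ind n.
have sa : sigma_algebra setT (past X n) by exact: smallest_sigma_algebra.
have indn A : past X n A -> forall B, measurable B ->
    PP1 (A `&` Es n @^-1` B) = PP1 A * P1 (E @^-1` B).
  by move=> pA B mB; rewrite ind// Es_iid.2.
split.
  exists (cst c%:E); last by apply/aeW => w /=.
  split; first exact: measurable_wrt_cst.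
  move=> A pA; have mA := past_measurable pA.
  rewrite integral_cst// muleC; apply/esym.
  apply: (integral_indep (g := @lne R) mA (mEs n) mE (indn A pA)) => //.
  by apply: nondecreasing_emeasurable; exact: le_lne.
move=> s ds; exists (cst (\int[P1]_x tilt c s (E x))); last first.
  by apply/aeW => w /=; exact: maj.
split; first exact: measurable_wrt_cst.
move=> A pA; have mA := past_measurable pA.
rewrite integral_cst// muleC; apply/esym.
apply: (ge0_integral_indep mA (mEs n) mE (indn A pA)).
  exact: measurable_tilt.
exact: tilt_ge0.
Qed.

End observations.

(** * The wealth bound, its optimal exponents and the aggregate property *)

Theorem proposition7p1 (R : realType) (d : measure_display)
    (X : measurableType d) (P0 P1 : probability X R)
    (P1P0 : P1 `<< P0)
    (PP0 PP1 : probability (seqspace X) R)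
    (PP0P0 : is_iid_law P0 PP0) (PP1P1 : is_iid_law P1 PP1)
    (Es : nat -> seqspace X -> \bar R) (Es_bet : betting_sequence PP0 Es)
    (E : X -> \bar R) (E_evar : e_variable P0 E)
    (Es_iid : iid_as P1 E PP1 Es)
    (c : R) (cE : \int[P1]_x lne (E x) = c%:E)
    (smax : \bar R) (smax_gt0 : 0 < smax)
    (psi : R -> \bar R) (psi_maj : majorant P1 E c smax psi)
    (alpha : R) (alpha01 : (0 < alpha < 1)%R) :
  let l : R := ln (alpha^-1) in
  let bound (t : nat) (sigma : R) : Prop :=
    gamma PP1 Es t alpha
      <= (alpha `^ (- sigma))%:E * expeR (- (t%:R%:E * rate smax psi c)) /\
    (alpha `^ (- sigma))%:E * expeR (- (t%:R%:E * rate smax psi c))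
      = expeR (- (t%:R%:E * rate smax psi c) + (sigma * l)%:E) in
  let f : R -> R := fun s => fine (psi s) in
  [/\ (* the bound, for either description of s^* *)
      forall (t : nat) (sstar : R), (l <= t%:R * c)%R ->
        maximiser smax psi c sstar \/ superdifferential smax psi c sstar ->
        bound t sstar,
      (* maximisers versus superdifferential *)
      (forall s : R, maximiser smax psi c s ->
         superdifferential smax psi c s) /\
      (convex_on_sdom smax psi -> lsc_on_sdom smax psi ->
       forall s : R, sdom smax s -> superdifferential smax psi c s ->
         maximiser smax psi c s),
      (* the differentiable, strictly convex case *)
      (forall s : R, sdom_int smax s -> psi s \is a fin_num) ->
      (forall s : R, sdom_int smax s -> derivable f s 1) ->
      strictly_convex_on (sdom_int smax) f ->
        (forall s : R, (0 < s)%R -> maximiser smax psi c s ->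
           derive1 f s = c /\
           forall u : R, sdom_int smax u -> derive1 f u = c -> u = s) /\
        (f s @[s --> at_right (0%R : R)] --> (0%R : R) ->
         forall u : R, sdom_int smax u -> derive1 f u = c ->
           maximiser smax psi c u /\
           forall s : R, maximiser smax psi c s -> s = u),
      (* the chord *)
      forall s0 rho kappa : R, (0 < s0)%R -> (0 < rho)%R ->
        smax = +oo ->
        \int[P1]_x tilt 0 s0 (E x) <= rho%:E ->
        kappa = (ln rho + s0 * c)%R -> (0 <= kappa)%R ->
        (forall s : R, (0 <= s)%R ->
           psi s = if (s <= s0)%R then (s / s0 * kappa)%:E else +oo) ->
        [/\ (rho <= 1)%R -> maximiser smax psi c s0,
            (rho < 1)%R -> forall s : R, maximiser smax psi c s -> s = s0 &
            forall t : nat, (l <= t%:R * c)%R -> bound t s0] &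
      (* (t c, t psi) is an aggregate *)
      independent_of_past PP1 Es -> homogeneous_aggregate PP1 Es c smax psi].
Proof.
move=> l bound f.
have [psi0 psi_ge0 maj] := psi_maj.
have [mE _ _] := E_evar.
have mEs k : measurable_fun setT (Es k).
  move=> _ B mB; rewrite setTI; have [_ + _] := Es_bet k.
  by move=> /(_ B mB); exact: past_measurable.
have Es_pos := iid_ae_pos mE mEs Es_iid cE.
have [a0 a1] := andP alpha01.
have super_bound (t : nat) (sigma : R) : (l <= t%:R * c)%R ->
    superdifferential smax psi c sigma -> bound t sigma.
  move=> ltc sd; split; last exact: powR_expeR.
  rewrite powR_expeR//.
  apply: (gamma_superdifferential mEs Es_iid.1 Es_pos smax_gt0) => //.
  by move=> k s ds; rewrite (iid_integral_tilt mE mEs Es_iid); exact: maj.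
have max_super s : maximiser smax psi c s -> superdifferential smax psi c s.
  exact: maximiser_superdifferential.
split.
- by move=> t s ltc [/max_super|]; exact: super_bound.
- split=> // cvx lsc s; exact: superdifferential_maximiser.
- move=> psi_fin df cvxf; split.
    move=> s s0 ms; split; first exact: derive1_maximiser_eq ms.
    by move=> u; exact: derive1_eq_maximiser ms.
  by move=> f0 u Du fu; exact: derive1_maximiser_unique.
- move=> s0 rho kappa s0_gt0 rho0 smaxE _ kappaE _ psiE.
  have {}psiE s : (0 <= s)%R ->
      psi s = if (s <= s0)%R then (s / s0 * (ln rho + s0 * c))%:E else +oo.
    by rewrite -kappaE; exact: psiE.
  have max_s0 : (rho <= 1)%R -> maximiser smax psi c s0.
    by rewrite smaxE; exact: (chord_maximiser s0_gt0 psiE).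
  split=> //.
    by move=> rho1 s; rewrite smaxE; exact: (chord_maximiser_unique s0_gt0 psiE).
  move=> t ltc; have [/max_s0/max_super|rho1] := leP rho 1%R.
    exact: super_bound.
  split; last exact: powR_expeR.
  (* For [rho > 1] the objective is largest at [s = 0], so the bound reduces to [exp (s0 l) >= 1],
     which dominates any probability. *)
  have r0 : rate smax psi c = 0.
    apply/eqP; rewrite eq_le rate_ge0// andbT smaxE.
    by apply: (chord_rate_le0 s0_gt0 psiE); exact: ltW.
  rewrite powR_expeR// r0 mule0 oppe0 add0e.
  apply: (@le_trans _ _ 1).
    by apply: probability_le1; exact: measurable_wealth_le.
  rewrite -expeR0 lee_expeR lee_fin mulr_ge0 ?(ltW s0_gt0)//.
  by rewrite ln_ge0// invf_ge1// ltW.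
- exact: (iid_homogeneous_aggregate mE mEs Es_iid cE psi_maj).
Qed.
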